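(* Let $\mathcal{E}$ be a collection of spaces. For any map $f:X\to Y$, $$\mathcal{E}\text{-}\mathrm{secat}(f)\le\mathrm{cat}_{\mathrm{FH}}(f)+\mathcal{E}\text{-}\mathrm{cat}_{\mathrm{CP}}(X).$$ In particular, $\mathrm{secat}(f)\le\mathrm{cat}_{\mathrm{FH}}(f)$.
   Context: All spaces are assumed to have the homotopy type of connected CW-complexes; spaces have no base points and maps are not required to preserve base points. A collection $\mathcal{E}$ of spaces means any collection of spaces containing the one-point space $*$. Given $f:X\to Y$, a subset $U\subseteq Y$ with inclusion $i:U\hookrightarrow Y$ is $\mathcal{E}$-section-categorical (with respect to $f$) if there are a space $E\in\mathcal{E}$ and maps $u:U\to E$, $v:E\to X$ with $fvu\simeq i$. The (reduced) $\mathcal{E}$-sectional category $\mathcal{E}\text{-}\mathrm{secat}(f)$ is the smallest integer $n\ge 0$ such that $Y$ has an open cover by $n+1$ subsets each of which is $\mathcal{E}$-section-categorical with respect to $f$ (and $\infty$ if no such $n$ exists). When $\mathcal{E}$ is the collection of all spaces, write $\mathrm{secat}(f)$ for $\mathcal{E}\text{-}\mathrm{secat}(f)$. The (reduced) $\mathcal{E}$-Clapp-Puppe category $\mathcal{E}\text{-}\mathrm{cat}_{\mathrm{CP}}(f)$ of a map $f:X\to Y$ is the smallest integer $n\ge0$ such that there are an open cover $\{U_0,\dots,U_n\}$ of $X$, spaces $E_i\in\mathcal{E}$ and maps $u_i:U_i\to E_i$, $v_i:E_i\to Y$ with $f|_{U_i}\simeq v_iu_i$ for each $i$ ($\infty$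 if no such $n$ exists). For a space $X$, $\mathcal{E}\text{-}\mathrm{cat}_{\mathrm{CP}}(X)=\mathcal{E}\text{-}\mathrm{cat}_{\mathrm{CP}}(\mathrm{id}_X)$. The (reduced) Fadell-Husseini category $\mathrm{cat}_{\mathrm{FH}}(f)$ of a map $f:X\to Y$ is defined as follows. Replacing $Y$ by the mapping cylinder $M_f$ of $f$, regard $f$ as an inclusion $X\subseteq Y$. Then $\mathrm{cat}_{\mathrm{FH}}(f)$ is the smallest $n\ge0$ such that there is an open cover $\{U_0,U_1,\dots,U_n\}$ of $Y$ with inclusions $j_i:U_i\to Y$ such that: (1) $j_i$ is homotopic to a constant map for $i=1,\dots,n$; (2) $X\subseteq U_0$; (3) there is a map $r:U_0\to X$ and a homotopy of pairs $j_0\simeq r:(U_0,X)\to(Y,X)$. It is $\infty$ if no such $n$ exists. *)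

(* Defs.v *)
From HB Require Import structures.
From Stdlib Require Import Relation_Operators.
From mathcomp Require Import all_boot all_order all_algebra generic_quotient.
From mathcomp Require Import all_classical all_reals all_analysis.

Set Implicit Arguments.
Unset Strict Implicit.
Unset Printing Implicit Defensive.

Import Order.TTheory GRing.Theory Num.Theory.
Import numFieldNormedType.Exports.

Local Open Scope classical_set_scope.
Local Open Scope ring_scope.
Local Open Scope quotient_scope.

(* Subsets [A : set T] are turned into spaces through [set_type A], which
   carries the subspace topology; [set_val : A -> T] is the inclusion. *)

Definition unitI (R : realType) : set R := `[0, 1]%classic.
Arguments unitI : clear implicits.

Section Interval.
Variable R : realType.

Lemma unitI_0 : (0 : R) \in unitI R.
Proof. by apply/mem_set; rewrite /unitI /= in_itv /= lexx ler01. Qed.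

Lemma unitI_1 : (1 : R) \in unitI R.
Proof. by apply/mem_set; rewrite /unitI /= in_itv /= lexx ler01. Qed.

Definition I0 : unitI R := exist _ 0 unitI_0.
Definition I1 : unitI R := exist _ 1 unitI_1.

End Interval.
Arguments I0 {R}.
Arguments I1 {R}.

Section Homotopy.
Variables (R : realType) (T Z : topologicalType).

Definition is_homotopy (f g : T -> Z) (H : T * unitI R -> Z) : Prop :=
  [/\ continuous H, forall x, H (x, I0) = f x & forall x, H (x, I1) = g x].

Definition homotopic (f g : T -> Z) : Prop := exists H, is_homotopy f g H.

Definition homotopic_to_constant (f : T -> Z) : Prop :=
  exists c : Z, homotopic f (fun=> c).

Definition homotopic_pairs (A : set T) (B : set Z) (f g : T -> Z) : Prop :=
  exists2 H, is_homotopy f g H & forall x t, A x -> B (H (x, t)).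

End Homotopy.

Definition homotopy_equivalent (R : realType) (T Z : topologicalType) : Prop :=
  exists (f : T -> Z) (g : Z -> T),
    [/\ continuous f, continuous g,
        homotopic R (g \o f) id & homotopic R (f \o g) id].

(* The norm of ['rV[R]_n] in the library is the sup norm, hence the explicit
   Euclidean formulas. For n = 0 both sets are the one-point space. *)
Definition disc (R : realType) (n : nat) : set 'rV[R]_n :=
  [set x | \sum_i x ord0 i ^+ 2 <= 1].
Arguments disc : clear implicits.

Definition disc_int (R : realType) (n : nat) : set (disc R n) :=
  [set x | \sum_i (set_val x : 'rV[R]_n) ord0 i ^+ 2 < 1].
Arguments disc_int : clear implicits.

Section CW.
Variables (R : realType) (T : topologicalType) (cell : Type) (dim : cell -> nat).
Variable (phi : forall e : cell, disc R (dim e) -> T).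

Definition open_cell (e : cell) : set T := @phi e @` disc_int R (dim e).

(* [phi e] is the characteristic map of the cell [e]. *)
Record is_cw_structure : Prop := IsCWStructure {
  cw_continuous : forall e, continuous (@phi e);
  (* [phi e] restricts to a homeomorphism from the open disc to the cell *)
  cw_injective : forall e (x y : disc R (dim e)),
    disc_int R (dim e) x -> disc_int R (dim e) y -> @phi e x = @phi e y -> x = y;
  cw_embedding : forall e (O : set (disc R (dim e))), open O ->
    exists2 V : set T, open V &
      @phi e @` (O `&` disc_int R (dim e)) = V `&` open_cell e;
  cw_disjoint : trivIset setT open_cell;
  cw_cover : \bigcup_e open_cell e = setT;
  cw_closure_finite : forall e, exists s : set cell,
    [/\ finite_set s, forall e', s e' -> (dim e' < dim e)%N &
        @phi e @` (~` disc_int R (dim e)) `<=` \bigcup_(e' in s) open_cell e'];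
  cw_weak_topology : forall A : set T,
    (forall e, closed (@phi e @^-1` A)) -> closed A
}.

End CW.

Definition is_cw_complex (R : realType) (T : topologicalType) : Prop :=
  hausdorff_space T /\
  exists (cell : Type) (dim : cell -> nat)
    (phi : forall e, disc R (dim e) -> T), is_cw_structure phi.

(* The library's [connected] holds of the empty set, which is excluded here. *)
Definition connected_cw_type (R : realType) (T : topologicalType) : Prop :=
  exists K : topologicalType,
    [/\ is_cw_complex R K, [set: K] !=set0, connected [set: K] &
        homotopy_equivalent R T K].

Record is_collection (R : realType) (E : topologicalType -> Prop) : Prop :=
  IsCollection {
    collection_spaces : forall T, E T -> connected_cw_type R T;
    collection_point : exists2 P, E P & exists p : P, forall q : P, q = p
  }.

Section LeastOrInfty.
Variables (R : realType) (P : nat -> Prop).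

Definition least_or_infty : \bar R :=
  if pselect (exists n, `[< P n >]) is left exP then ((ex_minn exP)%:R)%:E
  else +oo%E.

End LeastOrInfty.

Definition open_cover (T : topologicalType) (n : nat) (U : 'I_n.+1 -> set T) :
  Prop := (forall i, open (U i)) /\ \bigcup_i U i = setT.

Section Invariants.
Variables (R : realType) (E : topologicalType -> Prop).
Variables (X Y : topologicalType) (f : X -> Y).

Definition section_categorical (U : set Y) : Prop :=
  exists (W : topologicalType) (u : U -> W) (v : W -> X),
    [/\ E W, continuous u, continuous v & homotopic R (f \o v \o u) set_val].

Definition Esecat : \bar R :=
  least_or_infty R (fun n => exists2 U : 'I_n.+1 -> set Y,
    open_cover U & forall i, section_categorical (U i)).

Definition catCP : \bar R :=
  least_or_infty R (fun n => exists2 U : 'I_n.+1 -> set X,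
    open_cover U & forall i,
      exists (W : topologicalType) (u : U i -> W) (v : W -> Y),
        [/\ E W, continuous u, continuous v &
            homotopic R (f \o set_val) (v \o u)]).

End Invariants.

Definition catCP_space (R : realType) (E : topologicalType -> Prop)
  (X : topologicalType) : \bar R := catCP R E (@id X).

Definition secat (R : realType) (X Y : topologicalType) (f : X -> Y) : \bar R :=
  Esecat R (connected_cw_type R) f.

Section MappingCylinder.
Variables (R : realType) (X Y : topologicalType) (f : X -> Y).

(* The disjoint union of X x [0, 1] (index true) and Y (index false). *)
Definition cyl_part (b : bool) : topologicalType :=
  if b then (X * unitI R)%type : topologicalType else Y.
Definition cyl_sum : topologicalType := {b : bool & cyl_part b}.

Definition cyl_inX (p : X * unitI R) : cyl_sum := existT cyl_part true p.
Definition cyl_inY (y : Y) : cyl_sum := existT cyl_part false y.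

Inductive cyl_glue : cyl_sum -> cyl_sum -> Prop :=
  CylGlue x : cyl_glue (cyl_inX (x, I1)) (cyl_inY (f x)).

Definition cyl_rel (a b : cyl_sum) : bool :=
  `[< clos_refl_sym_trans cyl_sum cyl_glue a b >].

Lemma cyl_rel_refl : reflexive cyl_rel.
Proof. by move=> a; apply/asboolP; exact: rst_refl. Qed.

Lemma cyl_rel_sym : symmetric cyl_rel.
Proof.
by move=> a b; apply/idP/idP => /asboolP ab; apply/asboolP; exact: rst_sym.
Qed.

Lemma cyl_rel_trans : transitive cyl_rel.
Proof.
move=> b a c /asboolP ab /asboolP bc; apply/asboolP; exact: rst_trans bc.
Qed.

Canonical cyl_rel_equiv :=
  EquivRel cyl_rel cyl_rel_refl cyl_rel_sym cyl_rel_trans.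

Definition mapping_cylinder : topologicalType :=
  quotient_topology {eq_quot cyl_rel}.

Definition cyl_pi (a : cyl_sum) : mapping_cylinder :=
  \pi_{eq_quot cyl_rel} a.

(* X is identified with the free end X x {0} of the cylinder. *)
Definition cyl_incl (x : X) : mapping_cylinder := cyl_pi (cyl_inX (x, I0)).

Definition FH_cover (n : nat) (U : 'I_n.+1 -> set mapping_cylinder) : Prop :=
  [/\ open_cover U,
      forall i, i != ord0 ->
        homotopic_to_constant R (set_val : U i -> mapping_cylinder),
      range cyl_incl `<=` U ord0 &
      exists2 r : U ord0 -> X, continuous r &
        homotopic_pairs R (set_val @^-1` range cyl_incl) (range cyl_incl)
          (set_val : U ord0 -> mapping_cylinder) (cyl_incl \o r)].

Definition catFH : \bar R :=
  least_or_infty R (fun n => exists U, @FH_cover n U).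

End MappingCylinder.

(* Main.v *)
Require Import Defs.
From mathcomp Require Import all_boot all_order all_algebra generic_quotient.
From mathcomp Require Import all_classical all_reals all_analysis.
From Stdlib Require Import Relation_Operators.
From mathcomp Require Import lra.

(** Let M be the mapping cylinder of f, with collapse c : M -> Y and inclusion
j : Y -> M of the base, so that c j = id, while c restricts to f on the free
end X. Given an FH cover U_0, ..., U_n of M and a CP cover V_0, ..., V_m of X,
Y is covered by n + m + 1 open sets of two kinds.

For i >= 1, the inclusion of U_i in M is homotopic to a constant. Composing
with c and restricting along j, the inclusion of j^-1(U_i) in Y is homotopic to
a constant z. As Y is path connected, z can be moved to a point f(x0), and a
constant map at f(x0) factors through f by way of any nonempty member of the
collection ([nullhomotopic_section_categorical]).

For i = 0, the inclusion of U_0 in M is homotopic to r : U_0 -> X followed by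
the inclusion of the free end. Applying c, the inclusion of j^-1(U_0) in Y is
homotopic to f r. The preimages of the V_k under r split j^-1(U_0) into m + 1
open pieces; on the k-th piece r takes its values in V_k, and the inclusion of
V_k in X factors up to homotopy through a member of the collection. Composing
that factorization with f exhibits the piece as section-categorical
([retract_section_categorical]).

Thus E-secat(f) <= n + m. For the collection of all spaces, X itself is a
member, so X has CP category 0, which gives the second inequality.

Two facts of homotopy theory support the argument: homotopy is an equivalence
relation, and a space of the homotopy type of a connected CW complex is path
connected ([cw_type_const_homotopic]). *)

Set Implicit Arguments.
Unset Strict Implicit.
Unset Printing Implicit Defensive.

Import Order.TTheory GRing.Theory Num.Theory.
Import numFieldNormedType.Exports.

Local Open Scope classical_set_scope.
Local Open Scope ring_scope.
Local Open Scope quotient_scope.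

(** * Continuous maps, subspaces and pasting *)

Section ContinuousMaps.

Lemma continuous_compose (S T Z : topologicalType) (f : S -> T) (g : T -> Z) :
  continuous f -> continuous g -> continuous (g \o f).
Proof. by move=> cf cg x; apply: continuous_comp; [exact: cf|exact: cg]. Qed.

Lemma continuous_const (S T : topologicalType) (c : T) :
  continuous (fun _ : S => c).
Proof. by move=> x; exact: cvg_cst. Qed.

Lemma continuous_pairing (S T Z : topologicalType) (f : S -> T) (g : S -> Z) :
  continuous f -> continuous g -> continuous (fun x => (f x, g x)).
Proof. by move=> cf cg x; apply: cvg_pair; [exact: cf|exact: cg]. Qed.

Lemma continuous_fst (S T : topologicalType) : continuous (@fst S T).
Proof. by move=> x; exact: cvg_fst. Qed.

Lemma continuous_snd (S T : topologicalType) : continuous (@snd S T).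
Proof. by move=> x; exact: cvg_snd. Qed.

Lemma set_val_continuous (T : topologicalType) (A : set T) :
  continuous (set_val : A -> T).
Proof. exact: initial_continuous. Qed.

Definition corestrict (S T : Type) (A : set T) (g : S -> T)
  (gA : forall x, g x \in A) (x : S) : A := exist _ (g x) (gA x).

Lemma corestrict_continuous (S T : topologicalType) (A : set T) (g : S -> T)
    (gA : forall x, g x \in A) :
  continuous g -> continuous (corestrict gA).
Proof. by move=> cg; apply: continuous_comp_initial. Qed.

Lemma open_image_set_val (T : topologicalType) (A : set T) (O : set A) :
  open A -> open O -> open (set_val @` O).
Proof.
move=> oA [B oB <-].
suff -> : set_val @` (set_val @^-1` B : set A) = A `&` B by exact: openI.
apply/seteqP; split=> [_ [a Ba <-]|x [Ax Bx]].
  by split=> //; exact: set_valP.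
by exists (exist _ x (mem_set Ax)).
Qed.

Lemma paste_continuous (T Z : topologicalType) (A B : set T) (f g : T -> Z) :
  closed A -> closed B -> A `|` B = setT ->
  (forall x, A x -> B x -> f x = g x) -> continuous f -> continuous g ->
  continuous (fun x => if x \in A then f x else g x).
Proof.
move=> cA cB AB fg /continuous_closedP cf /continuous_closedP cg.
apply/continuous_closedP => C cC.
suff -> : (fun x => if x \in A then f x else g x) @^-1` C =
    (A `&` f @^-1` C) `|` (B `&` g @^-1` C).
  by apply: closedU; apply: closedI => //; [exact: cf|exact: cg].
apply/seteqP; split=> x /=.
  case: ifPn => [/set_mem Ax fC|/negP nA gC]; first by left.
  right; split=> //; have : (A `|` B) x by rewrite AB.
  by case=> // Ax; case: nA; exact: mem_set.
case=> -[Ax fC]; first by rewrite mem_set.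
by case: ifPn => [/set_mem Ax'|//]; rewrite fg.
Qed.

End ContinuousMaps.

(** * Reparametrizing the unit interval *)

Section UnitInterval.
Variable R : realType.

(** The retraction of the line onto [0, 1]. Composing it with affine maps
yields every reparametrization needed below as a total continuous map into the
subtype, with no membership proof to carry along. *)
Lemma clamp_subproof (x : R) : Num.max 0 (Num.min 1 x) \in unitI R.
Proof.
apply/mem_set; rewrite /unitI /= in_itv /= le_max lexx /=.
by rewrite ge_max ler01 ge_min lexx.
Qed.

Definition clamp : R -> unitI R := corestrict clamp_subproof.

Lemma clamp_continuous : continuous clamp.
Proof.
apply: corestrict_continuous.
apply: (@continuous_compose _ _ _ (fun x : R => (0, Num.min 1 x) : R * R)
   (fun p : R * R => Num.max p.1 p.2)); last exact: max_continuous.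
apply: continuous_pairing; first exact: continuous_const.
apply: (@continuous_compose _ _ _ (fun x : R => (1, x) : R * R)
   (fun p : R * R => Num.min p.1 p.2)); last exact: min_continuous.
by apply: continuous_pairing; [exact: continuous_const|move=> x; exact: cvg_id].
Qed.

Lemma clamp_le0 (x : R) : x <= 0 -> clamp x = I0.
Proof.
move=> x0; apply: val_inj => /=; rewrite min_r ?max_l//.
exact: le_trans x0 ler01.
Qed.

Lemma clamp_ge1 (x : R) : 1 <= x -> clamp x = I1.
Proof. by move=> x1; apply: val_inj => /=; rewrite min_l ?max_r// ler01. Qed.

End UnitInterval.

(** * Homotopy as a congruence *)

Section HomotopyRelation.
Variable R : realType.
Implicit Types T Z W : topologicalType.

Lemma homotopic_refl T Z (f : T -> Z) : continuous f -> homotopic R f f.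
Proof.
move=> cf; exists (f \o fst); split=> //.
exact: continuous_compose (@continuous_fst _ _) cf.
Qed.

(** With (a, b) equal to (-1, 1), (2, 0) and (2, -1), this gives the reversal
of a homotopy and the two halves of a concatenation. *)
Lemma homotopic_reparam T Z (H : T * unitI R -> Z) (a b : R) :
  continuous H ->
  continuous (fun p : T * unitI R => H (p.1, clamp (a * set_val p.2 + b))).
Proof.
move=> cH; apply: (@continuous_compose _ _ _
  (fun p : T * unitI R => (p.1, clamp (a * set_val p.2 + b))) H) => //.
apply: continuous_pairing; first exact: continuous_fst.
apply: (@continuous_compose _ _ _
  (fun p : T * unitI R => a * set_val p.2 + b) (@clamp R));
  last exact: clamp_continuous.
move=> p; apply: cvgD; last exact: cvg_cst.
apply: cvgM; first exact: cvg_cst.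
exact: (continuous_compose (@continuous_snd _ _) (@set_val_continuous _ _)).
Qed.

Lemma homotopic_sym T Z (f g : T -> Z) : homotopic R f g -> homotopic R g f.
Proof.
move=> [H [cH H0 H1]].
exists (fun p : T * unitI R => H (p.1, clamp (-1 * set_val p.2 + 1))); split.
- exact: homotopic_reparam.
- by move=> x /=; rewrite mulr0 add0r clamp_ge1.
- by move=> x /=; rewrite mulr1 addNr clamp_le0.
Qed.

Lemma homotopic_trans T Z (f g h : T -> Z) :
  homotopic R f g -> homotopic R g h -> homotopic R f h.
Proof.
move=> [H [cH H0 H1]] [K [cK K0 K1]].
pose s (p : T * unitI R) : R := set_val p.2.
have cs : continuous s.
  exact: (continuous_compose (@continuous_snd _ _) (@set_val_continuous _ _)).
pose A := s @^-1` [set t | t <= 2^-1].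
pose B := s @^-1` [set t | t >= 2^-1].
exists (fun p : T * unitI R =>
  if p \in A then H (p.1, clamp (2 * set_val p.2 + 0))
                 else K (p.1, clamp (2 * set_val p.2 + -1))); split.
- apply: (@paste_continuous _ _ A B).
  + by apply: preimage_closed => [x _|]; [exact: cs|exact: closed_le].
  + by apply: preimage_closed => [x _|]; [exact: cs|exact: closed_ge].
  + by apply/seteqP; split=> // p _; rewrite /A /B /=; have [] := leP (s p) 2^-1;
      [left|move=> /ltW; right].
  + move=> [x t]; rewrite /A /B /s /= => t1 t2.
    (* at time 1/2 both halves take the value g x *)
    have -> : set_val t = 2^-1 :> R by apply/eqP; rewrite eq_le t1 t2.
    by rewrite addr0 divff ?pnatr_eq0// subrr clamp_ge1// clamp_le0// H1 K0.
  + exact: homotopic_reparam.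
  + exact: homotopic_reparam.
- move=> x; rewrite mem_set /=; last by rewrite /A /s /= invr_ge0 ler0n.
  by rewrite mulr0 addr0 clamp_le0.
- move=> x; rewrite memNset /=.
    by rewrite clamp_ge1// -[set_val I1]/(1 : R); lra.
  by rewrite /A /s /= -[set_val I1]/(1 : R); apply/negP; rewrite -ltNge; lra.
Qed.

Lemma homotopic_precomp W T Z (k : W -> T) (f g : T -> Z) :
  continuous k -> homotopic R f g -> homotopic R (f \o k) (g \o k).
Proof.
move=> ck [H [cH H0 H1]]; exists (fun p : W * unitI R => H (k p.1, p.2)); split.
- apply: (@continuous_compose _ _ _
    (fun p : W * unitI R => (k p.1, p.2)) H) => //.
  apply: continuous_pairing; last exact: continuous_snd.
  exact: continuous_compose (@continuous_fst _ _) ck.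
- by move=> x /=; rewrite H0.
- by move=> x /=; rewrite H1.
Qed.

Lemma homotopic_postcomp T Z W (k : Z -> W) (f g : T -> Z) :
  continuous k -> homotopic R f g -> homotopic R (k \o f) (k \o g).
Proof.
move=> ck [H [cH H0 H1]]; exists (k \o H); split.
- exact: continuous_compose.
- by move=> x /=; rewrite H0.
- by move=> x /=; rewrite H1.
Qed.

End HomotopyRelation.

(** * Path connectedness of connected CW complexes *)

Section PathConnectedness.
Variable R : realType.

Lemma disc0_subproof n : (0 : 'rV[R]_n) \in disc R n.
Proof.
apply/mem_set; rewrite /disc /= big1 ?ler01// => i _.
by rewrite mxE expr0n.
Qed.

Definition disc0 n : disc R n := exist _ 0 (disc0_subproof n).

Lemma disc_shrink n (x : disc R n) (t : unitI R) :
  set_val t *: (set_val x : 'rV[R]_n) \in disc R n.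
Proof.
apply/mem_set; have /= xD := set_valP x; rewrite /disc /=.
have := set_valP t; rewrite /unitI /= in_itv /= => /andP[t0 t1].
apply: le_trans xD; apply: ler_sum => i _; rewrite mxE exprMn.
by rewrite ler_piMl ?sqr_ge0// expr_le1.
Qed.

(** Discs are star-shaped about the origin; homotopies of constant maps are
used in place of paths, with an arbitrary parameter space T. *)
Lemma disc_const_homotopic (T : topologicalType) n (x : disc R n) :
  homotopic R (fun _ : T => disc0 n) (fun=> x).
Proof.
exists (corestrict (disc_shrink x) \o snd); split.
- apply: continuous_compose; first exact: continuous_snd.
  apply: corestrict_continuous.
  apply: (@continuous_compose _ _ _ (set_val : unitI R -> R)
    (fun t : R => t *: (set_val x : 'rV[R]_n))); first exact: set_val_continuous.
  exact: scalel_continuous.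
- by move=> y /=; apply: val_inj; rewrite /= scale0r.
- by move=> y /=; apply: val_inj; rewrite /= scale1r.
Qed.

(** Let A be the path component of a. Closed cells are path connected, so both
A and its complement are saturated: each contains a closed cell as soon as it
meets it. By the weak topology any saturated set is closed, hence A is clopen
and nonempty. *)
Lemma cw_const_homotopic (T K : topologicalType) (a b : K) :
  is_cw_complex R K -> connected [set: K] ->
  homotopic R (fun _ : T => a) (fun=> b).
Proof.
move=> [_ [cell [dim [phi cw]]]] conK.
pose A := [set y | homotopic R (fun _ : T => a) (fun=> y)].
have joined e (x y : disc R (dim e)) : A (phi e x) -> A (phi e y).
  move=> Ax; apply: homotopic_trans Ax _.
  apply: (homotopic_postcomp (k := phi e) (f := fun=> x) (g := fun=> y)).
    exact: cw_continuous cw e.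
  apply: homotopic_trans (disc_const_homotopic T y).
  exact/homotopic_sym/disc_const_homotopic.
have clopen_preimage (D : set K) :
    (forall e (x y : disc R (dim e)), D (phi e x) -> D (phi e y)) -> closed D.
  move=> sat; apply: (cw_weak_topology cw) => e.
  have [Dx|nD] := pselect (D (phi e (disc0 (dim e)))).
    suff -> : phi e @^-1` D = setT by exact: closedT.
    by apply/seteqP; split=> // y _; exact: sat Dx.
  suff -> : phi e @^-1` D = set0 by exact: closed0.
  by apply/seteqP; split=> // y /= /sat - /(_ (disc0 _)).
have cA : closed A by exact: clopen_preimage.
have oA : open A.
  rewrite -[A]setCK; apply: closed_openC; apply: clopen_preimage => e x y nAx Ay.
  by apply: nAx; exact: joined Ay.
have AT : A = setT.
  apply: conK.
  - by exists a; apply: homotopic_refl; exact: continuous_const.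
  - by exists A => //; rewrite setTI.
  - by exists A => //; rewrite setTI.
by have : A b by rewrite AT.
Qed.

(** A homotopy equivalence g with inverse h joins each z to h (g z), and h maps
paths of the CW complex to paths. *)
Lemma cw_type_const_homotopic (T Z : topologicalType) (a b : Z) :
  connected_cw_type R Z -> homotopic R (fun _ : T => a) (fun=> b).
Proof.
move=> [K [cwK _ conK [g [h [cg ch hg _]]]]].
have back (z : Z) : homotopic R (fun _ : T => h (g z)) (fun=> z).
  by apply: (homotopic_precomp (k := fun=> z)) hg; exact: continuous_const.
apply: homotopic_trans (back b); apply: homotopic_trans (homotopic_sym (back a)) _.
apply: (homotopic_postcomp (k := h) (f := fun=> g a) (g := fun=> g b)) => //.
exact: cw_const_homotopic.
Qed.

End PathConnectedness.

(** * The collapse of the mapping cylinder onto its base *)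

Section Cylinder.
Variables (R : realType) (X Y : topologicalType) (f : X -> Y).
Hypothesis cf : continuous f.
Local Notation M := (mapping_cylinder R f).

Definition cyl_sum_collapse : cyl_sum R X Y -> Y :=
  unstable.sigT_fun (fun b => if b return cyl_part R X Y b -> Y
                     then f \o fst else id).

Definition cyl_collapse : M -> Y := cyl_sum_collapse \o repr.

(** The gluing identifies (x, 1) with f x, and both have image f x. *)
Lemma cyl_sum_collapse_glue (a b : cyl_sum R X Y) :
  clos_refl_sym_trans _ (@cyl_glue R X Y f) a b ->
  cyl_sum_collapse a = cyl_sum_collapse b.
Proof. by elim=> // [_ _ []|x y z _ -> _ ->]. Qed.

Lemma cyl_collapse_pi (a : cyl_sum R X Y) :
  cyl_collapse (cyl_pi f a) = cyl_sum_collapse a.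
Proof.
apply: cyl_sum_collapse_glue.
have /eqmodP/asboolP// : repr (cyl_pi f a) = a %[mod {eq_quot @cyl_rel R X Y f}].
exact: reprK.
Qed.

Lemma cyl_collapse_continuous : continuous cyl_collapse.
Proof.
apply/quotient_continuous.
have -> : cyl_collapse \o \pi = cyl_sum_collapse.
  by apply/funext => a; exact: cyl_collapse_pi.
apply: sigT_continuous => -[]; last by move=> x; exact: cvg_id.
exact: continuous_compose (@continuous_fst _ _) cf.
Qed.

Lemma cyl_collapse_incl (x : X) : cyl_collapse (cyl_incl R f x) = f x.
Proof. exact: cyl_collapse_pi. Qed.

Definition cyl_base (y : Y) : M := cyl_pi f (cyl_inY R X y).

Lemma cyl_base_continuous : continuous cyl_base.
Proof.
apply: (continuous_compose (f := @cyl_inY R X Y)).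
  exact: (@existT_continuous _ (cyl_part R X Y) false).
exact: pi_continuous.
Qed.

Lemma cyl_collapse_base (y : Y) : cyl_collapse (cyl_base y) = y.
Proof. exact: cyl_collapse_pi. Qed.

End Cylinder.

(** * Section-categorical pieces of the base *)

Section SectionCategorical.
Variables (R : realType) (E : topologicalType -> Prop).
Variables (X Y : topologicalType) (f : X -> Y).
Hypotheses (cf : continuous f) (hY : connected_cw_type R Y).
Variables (W : topologicalType) (EW : E W) (w0 : W) (x0 : X).
Local Notation M := (mapping_cylinder R f).

Lemma base_in (U : set M) (y : cyl_base R f @^-1` U) :
  cyl_base R f (set_val y) \in U.
Proof. exact/mem_set/(set_valP y). Qed.

(** The factorization is U -> W -> X with both maps constant, at w0 and x0; path
connectedness of Y moves the constant produced by the null-homotopy to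
f x0. *)
Lemma nullhomotopic_section_categorical (U : set M) :
  homotopic_to_constant R (set_val : U -> M) ->
  section_categorical R E f (cyl_base R f @^-1` U).
Proof.
move=> [c Hc]; set D := cyl_base R f @^-1` U.
exists W, (fun=> w0), (fun=> x0); split=> //; try exact: continuous_const.
apply: homotopic_trans (cw_type_const_homotopic D _ (cyl_collapse c) hY) _.
apply: homotopic_sym.
pose g : D -> U := corestrict (@base_in U).
have cg : continuous g.
  apply: corestrict_continuous; apply: continuous_compose.
    exact: set_val_continuous.
  exact: cyl_base_continuous.
have := homotopic_postcomp (cyl_collapse_continuous cf) (homotopic_precomp cg Hc).
congr homotopic; apply/funext => y; exact: cyl_collapse_base.
Qed.

(** The piece is the set of those y whose image j(y) in the cylinder lies in U
and is sent into V by r. On it, with c the collapse,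
  f (v u) r j ~ f r j = c i r j ~ c j = id,
where i is the inclusion of the free end. *)
Lemma retract_section_categorical (U : set M) (r : U -> X) (V : set X)
    (W' : topologicalType) (u : V -> W') (v : W' -> X) :
  continuous r -> homotopic R (set_val : U -> M) (cyl_incl R f \o r) ->
  E W' -> continuous u -> continuous v ->
  homotopic R (set_val : V -> X) (v \o u) ->
  section_categorical R E f (cyl_base R f @^-1` (set_val @` (r @^-1` V))).
Proof.
move=> cr Hr EW' cu cv Huv; set D := cyl_base R f @^-1` _.
have DU (y : D) : cyl_base R f (set_val y) \in U.
  by have [a _ <-] := set_valP y; exact/mem_set/(set_valP a).
pose g : D -> U := corestrict DU.
have cg : continuous g.
  apply: corestrict_continuous; apply: continuous_compose.
    exact: set_val_continuous.
  exact: cyl_base_continuous.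
have DV (y : D) : r (g y) \in V.
  apply/mem_set; have [a Va aE] := set_valP y.
  by suff -> : g y = a by []; apply: val_inj.
pose q : D -> V := corestrict DV.
have cq : continuous q.
  by apply: corestrict_continuous; exact: continuous_compose cg cr.
exists W', (u \o q), v; split=> //; first exact: continuous_compose cq cu.
have := homotopic_postcomp cf (homotopic_precomp cq Huv).
move=> /homotopic_sym /homotopic_trans; apply.
have := homotopic_postcomp (cyl_collapse_continuous cf) (homotopic_precomp cg Hr).
move=> /homotopic_sym; congr homotopic; apply/funext => y.
  exact: cyl_collapse_incl.
exact: cyl_collapse_base.
Qed.

(** The indices k <= m enumerate the pieces of the base cut out of U_0 by the
V_k, and the indices m + i with 1 <= i <= n the traces of the U_i, which makes
n + m + 1 sets in all. *)
Lemma section_categorical_cover n m (U : 'I_n.+1 -> set M)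
    (V : 'I_m.+1 -> set X) :
  FH_cover U -> open_cover V ->
  (forall j, exists (W' : topologicalType) (u : V j -> W') (v : W' -> X),
    [/\ E W', continuous u, continuous v &
        homotopic R (id \o set_val) (v \o u)]) ->
  exists2 D : 'I_(n + m).+1 -> set Y,
    open_cover D & forall k, section_categorical R E f (D k).
Proof.
move=> [[oU UT] Unull _ [r cr [H Hr _]]] [oV VT] HV.
exists (fun k => if (k <= m)%N
  then cyl_base R f @^-1` (set_val @` (r @^-1` V (inord k)))
  else cyl_base R f @^-1` U (inord (k - m))).
- have obase (O : set M) : open O -> open (cyl_base R f @^-1` O).
    by move: O; apply/continuousP; exact: cyl_base_continuous.
  split=> [k|].
    case: ifP => _; apply: obase => //.
    by apply: open_image_set_val => //; move/continuousP: cr; apply.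
  apply/seteqP; split=> // y _.
  have [i _ Ui] : (\bigcup_i U i) (cyl_base R f y) by rewrite UT.
  have [i0|i0] := eqVneq i ord0.
    rewrite i0 in Ui;
    pose b : U ord0 := exist _ (cyl_base R f y) (mem_set Ui).
    have [j _ Vj] : (\bigcup_j V j) (r b) by rewrite VT.
    have jm : (j <= m)%N by rewrite -ltnS.
    exists (inord j) => //; rewrite inordK; last first.
      by rewrite ltnS (leq_trans jm) ?leq_addl.
    rewrite jm.
    by exists b => //=; rewrite inord_val.
  have im : (i + m < (n + m).+1)%N by rewrite ltnS leq_add2r -ltnS.
  exists (inord (i + m)) => //; rewrite inordK// leqNgt -[X in (X < _)%N]add0n.
  by rewrite ltn_add2r lt0n i0 /= addnK inord_val.
- move=> k; case: leqP => km.
    have [W' [u [v [EW' cu cv Huv]]]] := HV (inord k).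
    by apply: (retract_section_categorical cr _ EW' cu cv Huv); exists H.
  apply: nullhomotopic_section_categorical; apply: Unull.
  rewrite -val_eqE /= inordK ?subn_eq0 -?ltnNge//.
  by rewrite ltnS leq_subLR [leqRHS]addnC; exact: (ltn_ord k).
Qed.

End SectionCategorical.

Local Open Scope ereal_scope.

(** * Comparison of the invariants *)

Section Invariants.
Variable R : realType.

Lemma least_or_infty_le (P : nat -> Prop) n :
  P n -> least_or_infty R P <= n%:R%:E.
Proof.
move=> Pn; rewrite /least_or_infty; case: pselect => [exP|nP].
  by case: ex_minnP => k _ kmin; rewrite lee_fin ler_nat kmin//; exact/asboolP.
by case: nP; exists n; exact/asboolP.
Qed.

(** Any infinite summand makes the right-hand side infinite, so only two
attained minima have to be compared. *)
Lemma least_or_infty_add (P Q S : nat -> Prop) :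
  (forall n m, P n -> Q m -> S (n + m)%N) ->
  least_or_infty R S <= least_or_infty R P + least_or_infty R Q.
Proof.
move=> PQS; rewrite [X in _ <= X + _]/least_or_infty.
rewrite [X in _ <= _ + X]/least_or_infty.
case: pselect => [exP|_]; case: pselect => [exQ|_]; rewrite ?leey//.
case: ex_minnP => n /asboolP Pn _; case: ex_minnP => m /asboolP Qm _.
by rewrite -EFinD -natrD; apply: least_or_infty_le; exact: PQS.
Qed.

Lemma catCP_space_self (E : topologicalType -> Prop) (X : topologicalType) :
  E X -> catCP_space R E X <= 0.
Proof.
move=> EX; apply: (@least_or_infty_le _ 0).
exists (fun=> setT).
  by split=> [i|]; [exact: openT|apply/seteqP; split=> // x _; exists ord0].
move=> i; exists X, set_val, id; split=> //.
- exact: set_val_continuous.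
- by move=> x; exact: cvg_id.
- by apply: homotopic_refl; exact: set_val_continuous.
Qed.

(** The constant maps on the null-homotopic pieces pass through W: a point for
a general collection, X itself for the collection of all spaces. *)
Lemma Esecat_le (E : topologicalType -> Prop) (X Y W : topologicalType)
    (f : X -> Y) :
  continuous f -> connected_cw_type R Y -> X -> E W -> W ->
  Esecat R E f <= catFH R f + catCP_space R E X.
Proof.
move=> cf hY x0 EW w0; apply: least_or_infty_add => n m [U FHU] [V oV HV].
exact: (section_categorical_cover cf hY EW w0 x0 FHU oV HV).
Qed.

End Invariants.

Theorem corollary5p8 (R : realType) (X Y : topologicalType)
    (hX : connected_cw_type R X) (hY : connected_cw_type R Y)
    (f : X -> Y) (cf : continuous f) :
  (forall E : topologicalType -> Prop, is_collection R E ->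
     Esecat R E f <= catFH R f + catCP_space R E X) /\
  secat R f <= catFH R f.
Proof.
have [K [_ [k0 _] _ [_ [h _]]]] := hX.
split=> [E [_ [P EP [p _]]]|]; first exact: Esecat_le cf hY (h k0) EP p.
apply: le_trans (Esecat_le (E := connected_cw_type R) cf hY (h k0) hX (h k0)) _.
rewrite -[leRHS]adde0; apply: leeD2l.
exact: (catCP_space_self R hX).
Qed.
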